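(* For all particles $j=1,\dots,J$, the mean-field particles satisfy, as $i\to\infty$: (a) $\widetilde{\mathbf v}_{i+1}^{(j)}\to\widetilde{\mathbf v}_\infty^{(j)}=\mathbf P\mathbf v_\star^{(j)}+\mathbf S\mathbf v_0^{(j)}$; (b) $\mathbb E\big[\widetilde{\mathbf v}_{i+1}^{(j)}\big]\to\mathbb E\big[\widetilde{\mathbf v}_\infty^{(j)}\big]=\mathbf P\mathbf v^\star+\mathbf S\boldsymbol\mu_0$; (c) $\mathrm{Cov}\big[\widetilde{\mathbf v}_{i+1}^{(j)}\big]\to\mathrm{Cov}\big[\widetilde{\mathbf v}_\infty^{(j)}\big]=\mathbf P(\mathbf H^\top\boldsymbol\Gamma^{-1}\mathbf H)^\dagger\mathbf P^\top+\mathbf S\widetilde{\mathbf C}_0\mathbf S^\top$.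
   Context: Let $\mathbf H\in\mathbb R^{n\times d}$, $\boldsymbol\Gamma\in\mathbb R^{n\times n}$ symmetric positive definite, $\mathbf y\in\mathbb R^n$, $\boldsymbol\mu_0\in\mathbb R^d$, and $\widetilde{\mathbf C}_0\in\mathbb R^{d\times d}$ symmetric positive semidefinite. Let $\dagger$ be the Moore–Penrose pseudoinverse and $\mathbf H^+=(\mathbf H^\top\boldsymbol\Gamma^{-1}\mathbf H)^\dagger\mathbf H^\top\boldsymbol\Gamma^{-1}$. For $j=1,\dots,J$ the initial particles $\mathbf v_0^{(j)}\in\mathbb R^d$ are random with mean $\boldsymbol\mu_0$ and covariance $\widetilde{\mathbf C}_0$; the perturbations $\boldsymbol\varepsilon^{(j)}\sim\mathcal N(\mathbf 0,\boldsymbol\Gamma)$ are i.i.d. and independent of the initial particles; $\mathbf y^{(j)}=\mathbf y+\boldsymbol\varepsilon^{(j)}$, $\mathbf v_\star^{(j)}=\mathbf H^+\mathbf y^{(j)}$ and $\mathbf v^\star=\mathbf H^+\mathbf y$. Mean-field iteration: for $i\ge 0$ define recursively $$\widetilde{\mathbf M}_i=\big(\mathbf I+\widetilde{\mathbf C}_i\mathbf H^\top\boldsymbol\Gamma^{-1}\mathbf H\big)^{-1},\qquad \widetilde{\mathbf M}_{i:0}=\widetilde{\mathbf M}_i\cdots\widetilde{\mathbf M}_0,$$ $$\widetilde{\mathbf C}_{i+1}=\widetilde{\mathbf M}_{i:0}\widetilde{\mathbf C}_0\widetilde{\mathbf M}_{i:0}^\top+(\mathbf I-\widetilde{\mathbf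 M}_{i:0})(\mathbf H^\top\boldsymbol\Gamma^{-1}\mathbf H)^\dagger(\mathbf I-\widetilde{\mathbf M}_{i:0})^\top.$$ The mean-field particles are $\widetilde{\mathbf v}_{i+1}^{(j)}=\widetilde{\mathbf M}_{i:0}\mathbf v_0^{(j)}+(\mathbf I-\widetilde{\mathbf M}_{i:0})\mathbf v_\star^{(j)}$. Expectation and covariance are over the initial particles and the perturbations. The eigenvectors of $\widetilde{\mathbf C}_i\mathbf H^\top\boldsymbol\Gamma^{-1}\mathbf H$ can be taken independent of $i$; write $\widetilde{\mathbf C}_i\mathbf H^\top\boldsymbol\Gamma^{-1}\mathbf H\,\mathbf u_\ell=\lambda_{\ell,i}\mathbf u_\ell$. Let $r$ be the number of strictly positive eigenvalues (independent of $i$), indexed so that $\lambda_{1,1}\ge\cdots\ge\lambda_{r,1}>0$, and $\mathbf U=[\mathbf u_1,\dots,\mathbf u_r]$ the matrix of corresponding eigenvectors, normalized so that $\mathbf U^\top\mathbf H^\top\boldsymbol\Gamma^{-1}\mathbf H\mathbf U=\mathbf I_r$. Set $\mathbf P=\mathbf U\mathbf U^\top\mathbf H^\top\boldsymbol\Gamma^{-1}\mathbf H$ and $\mathbf S=\mathbf I-\mathbf P$. *)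

(* Defs.v *)
From HB Require Import structures.
From mathcomp Require Import all_boot all_order all_algebra.
From mathcomp Require Import all_classical all_reals all_analysis.

Set Implicit Arguments.
Unset Strict Implicit.
Unset Printing Implicit Defensive.

Import Order.TTheory GRing.Theory Num.Theory.
Import numFieldNormedType.Exports.

Local Open Scope classical_set_scope.
Local Open Scope ring_scope.

Section LinearAlgebra.
Context {R : realType}.

Definition quad_form p (A : 'M[R]_p) (x : 'cV[R]_p) : R := (x^T *m A *m x) 0 0.

Definition sym_psd p (A : 'M[R]_p) : Prop :=
  A^T = A /\ forall x, 0 <= quad_form A x.

Definition sym_pd p (A : 'M[R]_p) : Prop :=
  A^T = A /\ forall x, x != 0 -> 0 < quad_form A x.

(* The four Penrose conditions; mathcomp's [pinvmx] is only a partial inverse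
   and does not satisfy the two symmetry conditions. *)
Definition penrose p q (A : 'M[R]_(p, q)) (B : 'M[R]_(q, p)) : Prop :=
  [/\ A *m B *m A = A, B *m A *m B = B,
      (A *m B)^T = A *m B & (B *m A)^T = B *m A].

Definition mp_pinv p q (A : 'M[R]_(p, q)) : 'M[R]_(q, p) :=
  xget 0 [set B | penrose A B].

Lemma mulmx_tr_eq0 p q (x : 'M[R]_(p, q)) : x *m x^T = 0 -> x = 0.
Proof.
move=> xx0; apply/matrixP => i j; rewrite mxE.
have /eqP := congr1 (fun M : 'M[R]_p => M i i) xx0.
rewrite !mxE psumr_eq0; last by move=> k _; rewrite mxE -expr2 sqr_ge0.
by move=> /allP /(_ j (mem_index_enum j)); rewrite mxE /= mulf_eq0 orbb => /eqP.
Qed.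

Lemma gram_unitmx p q (G : 'M[R]_(p, q)) : row_free G -> G *m G^T \in unitmx.
Proof.
move=> fG; rewrite -row_free_unit; apply/inj_row_free => v vGG.
have vG : v *m G = 0.
  by apply: mulmx_tr_eq0; rewrite trmx_mul mulmxA -(mulmxA v) vGG mul0mx.
by apply: (row_free_inj fG); rewrite vG mul0mx.
Qed.

Lemma penrose_exists p q (A : 'M[R]_(p, q)) : exists B, penrose A B.
Proof.
have [k [F [G [AE uF uG]]]] : exists k (F : 'M[R]_(p, k)) (G : 'M[R]_(k, q)),
    [/\ A = F *m G, F^T *m F \in unitmx & G *m G^T \in unitmx].
  exists (\rank A), (col_base A), (row_base A); rewrite mulmx_base; split=> //.
    rewrite -{2}(trmxK (col_base A)); apply: gram_unitmx.
    by rewrite /row_free mxrank_tr; exact: col_base_full.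
  by apply: gram_unitmx; exact: row_base_free.
pose L := invmx (F^T *m F) *m F^T; pose K := G^T *m invmx (G *m G^T).
have LF : L *m F = 1%:M by rewrite /L -mulmxA mulVmx.
have GK : G *m K = 1%:M by rewrite /K mulmxA mulmxV.
have FL : (F *m L)^T = F *m L.
  by rewrite /L !trmx_mul trmxK trmx_inv trmx_mul trmxK mulmxA.
have KG : (K *m G)^T = K *m G.
  by rewrite /K !trmx_mul trmxK trmx_inv trmx_mul trmxK mulmxA.
have AB : A *m (K *m L) = F *m L.
  by rewrite AE mulmxA -(mulmxA F) GK mulmx1.
have BA : K *m L *m A = K *m G.
  by rewrite AE mulmxA -(mulmxA K) LF mulmx1.
exists (K *m L); split; rewrite ?AB ?BA //.
  by rewrite AE mulmxA -(mulmxA F) LF mulmx1.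
by rewrite mulmxA -(mulmxA K) GK mulmx1.
Qed.

Lemma mp_pinvP p q (A : 'M[R]_(p, q)) : penrose A (mp_pinv A).
Proof. exact: (xgetPex 0 (penrose_exists A)). Qed.

End LinearAlgebra.

Section RandomVectors.
Context {disp : measure_display} {Om : measurableType disp} {R : realType}.
Variable P : probability Om R.

(* Entries in [\bar R]: no finiteness is built into the definitions. *)
Definition mean_vec p (X : Om -> 'cV[R]_p) : 'cV[\bar R]_p :=
  \matrix_(k, l) ('E_P[fun w => X w k l])%E.

Definition cov_mx p (X : Om -> 'cV[R]_p) : 'M[\bar R]_p :=
  \matrix_(k, l) covariance P (fun w => X w k 0) (fun w => X w l 0).

Definition measurable_vec p (X : Om -> 'cV[R]_p) : Prop :=
  forall k, measurable_fun [set: Om] (fun w => X w k 0).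

Definition square_integrable_vec p (X : Om -> 'cV[R]_p) : Prop :=
  forall k, (fun w => X w k 0) \in Lfun P 2%:E.

(* N(m, s2), parametrised by the variance.  The library's [normal_prob] takes
   the standard deviation, and is the uniform law on [0, 1] when that is 0. *)
Definition gaussian1 (m s2 : R) (B : set R) : \bar R :=
  if s2 == 0 then \d_m B else normal_prob m (Num.sqrt s2) B.

(* Multivariate normal law, through all linear functionals. *)
Definition gaussian_vec p (X : Om -> 'cV[R]_p) (m : 'cV[R]_p) (S : 'M[R]_p)
    : Prop :=
  measurable_vec X /\
  forall (a : 'cV[R]_p) (B : set R), measurable B ->
    P ((fun w => (a^T *m X w) 0 0) @^-1` B) =
    gaussian1 ((a^T *m m) 0 0) (quad_form S a) B.

Definition sigma_vec (I : Type) p (X : I -> Om -> 'cV[R]_p) : set (set Om) :=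
  <<s [set E | exists i k (B : set R),
         measurable B /\ E = (fun w => X i w k 0) @^-1` B] >>.

Definition mutual_indep (I : finType) (F : I -> set (set Om)) : Prop :=
  forall (K : {set I}) (E : I -> set Om), (forall i, i \in K -> F i (E i)) ->
    P (\bigcap_(i in [set` K]) E i) = (\prod_(i in K) P (E i))%E.

(* The classes sigma(eps_1), ..., sigma(eps_J) and sigma(v_1, ..., v_J); no
   independence is required among the v_j. *)
Definition noise_sigmas J p q (v : 'I_J -> Om -> 'cV[R]_p)
    (eps : 'I_J -> Om -> 'cV[R]_q) (o : option 'I_J) : set (set Om) :=
  if o is Some j then sigma_vec (fun _ : unit => eps j) else sigma_vec v.

End RandomVectors.

Section MeanField.
Context {R : realType} {n d : nat}.
Variables (H : 'M[R]_(n, d)) (Gamma : 'M[R]_n) (C0 : 'M[R]_d).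

Definition hess : 'M[R]_d := H^T *m invmx Gamma *m H.

Definition Hplus : 'M[R]_(d, n) := mp_pinv hess *m H^T *m invmx Gamma.

(* [mf_state i] is the pair (C_i, M_{i-1} ... M_0), the product being the
   identity for i = 0. *)
Fixpoint mf_state (i : nat) : 'M[R]_d * 'M[R]_d :=
  if i is i'.+1 then
    let: (C, Mprev) := mf_state i' in
    let M := invmx (1%:M + C *m hess) *m Mprev in
    (M *m C0 *m M^T + (1%:M - M) *m mp_pinv hess *m (1%:M - M)^T, M)
  else (C0, 1%:M).

Definition mf_cov (i : nat) : 'M[R]_d := (mf_state i).1.

(* M_i ... M_0 *)
Definition mf_prod (i : nat) : 'M[R]_d := (mf_state i.+1).2.

(* The particle at step i.+1, started from v0 and with observation target
   vstar. *)
Definition mf_particleS (i : nat) (v0 vstar : 'cV[R]_d) : 'cV[R]_d :=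
  mf_prod i *m v0 + (1%:M - mf_prod i) *m vstar.

End MeanField.

(* Main.v *)
Require Import Defs.
From HB Require Import structures.
From mathcomp Require Import all_boot all_order all_algebra.
From mathcomp Require Import all_classical all_reals all_analysis.
From mathcomp Require Import measurable_realfun ring lra.

Set Implicit Arguments.
Unset Strict Implicit.
Unset Printing Implicit Defensive.

Import Order.TTheory GRing.Theory Num.Theory.
Import numFieldNormedType.Exports.

Local Open Scope classical_set_scope.
Local Open Scope ring_scope.

(** Write [A] for the Hessian [H^T Gamma^-1 H]. The proof rests on two
    independent facts.

    The contractions converge. In the eigenbasis [W] every step is diagonal, so
    the product [M] of the first [i] steps multiplies an eigenvector by
    [m_i = prod_(k < i) 1 / (1 + lambda_k)]. Eigenvectors with distinct
    eigenvalues are [A]-orthogonal, hence [M^T A = A M] ([mf_prod_hess_sym]), and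
    the covariance update becomes a scalar recursion on each eigendirection
    ([mf_eigenvalueS]):

      [lambda_i = m_i^2 lambda_0 + (1 - m_i)^2].

    If [lambda_0 = 0], then [m_i] stays equal to 1. Otherwise it drops below 1
    at the first step, the second term then bounds the eigenvalues from below,
    and [m_i] decays geometrically ([factor_cvg0]). So [M] tends to the projector
    that keeps the eigenvectors with zero eigenvalue and kills the other ones.
    With the normalization of [U], this is [S = 1 - U U^T A] ([mf_prod_cvg]).

    The moments are explicit. For any fixed matrix [M], the particle
    [M v0 + (1 - M) Hplus (y + eps)] is an affine image of two uncorrelated
    square-integrable vectors, with mean [M mu0 + (1 - M) vstar] and covariance
    [M C0 M^T + (1 - M) A^+ (1 - M)^T] ([mean_vec_mix], [cov_mx_mix]). The
    moments of the noise are recovered from its one-dimensional projections: the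
    mean vanishes by symmetry, the variance comes from an integration by parts,
    and the covariances follow by polarization. That the noise is uncorrelated
    with the initial particles is Fubini for the joint law.

    Both the particle at each step and its limit have this form, with [M] the
    current product and [M = S] respectively, so the three claims follow by
    continuity in [M]. *)

(** * Positive semidefinite matrices and pseudoinverses *)

Section PsdMatrices.
Context {R : realType}.

Lemma quad_form_congr p q (A : 'M[R]_p) (B : 'M[R]_(q, p)) (x : 'cV[R]_q) :
  quad_form (B *m A *m B^T) x = quad_form A (B^T *m x).
Proof. by rewrite /quad_form trmx_mul trmxK !mulmxA. Qed.

Lemma quad_formD p (A B : 'M[R]_p) (x : 'cV[R]_p) :
  quad_form (A + B) x = quad_form A x + quad_form B x.
Proof. by rewrite /quad_form mulmxDr mulmxDl mxE. Qed.

Lemma sym_psd_congr p q (A : 'M[R]_p) (B : 'M[R]_(q, p)) :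
  sym_psd A -> sym_psd (B *m A *m B^T).
Proof.
move=> [As A0]; split; first by rewrite !trmx_mul trmxK As mulmxA.
by move=> x; rewrite quad_form_congr.
Qed.

Lemma sym_psdD p (A B : 'M[R]_p) : sym_psd A -> sym_psd B -> sym_psd (A + B).
Proof.
move=> [As A0] [Bs B0]; split; first by rewrite raddfD /= As Bs.
by move=> x; rewrite quad_formD addr_ge0.
Qed.

Lemma sym_pd_psd p (A : 'M[R]_p) : sym_pd A -> sym_psd A.
Proof.
move=> [As A0]; split=> // x.
have [->|/A0/ltW//] := eqVneq x 0.
by rewrite /quad_form mulmx0 mxE.
Qed.

Lemma sym_pd_unitmx p (A : 'M[R]_p) : sym_pd A -> A \in unitmx.
Proof.
move=> [_ A0]; rewrite -row_free_unit; apply/inj_row_free => v vA.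
apply: contra_eq vA => v0; have /A0 : v^T != 0 by rewrite trmx_eq0.
apply: contraTneq => vA.
by rewrite /quad_form trmxK vA mul0mx mxE ltxx.
Qed.

Lemma sym_pd_invmx p (A : 'M[R]_p) : sym_pd A -> sym_pd (invmx A).
Proof.
move=> Apd; have uA := sym_pd_unitmx Apd; have [As A0] := Apd.
split; first by rewrite trmx_inv As.
move=> x x0; have -> : invmx A = invmx A *m A *m (invmx A)^T.
  by rewrite mulVmx// mul1mx trmx_inv As.
rewrite quad_form_congr; apply: A0; apply: contra_neq x0 => Ax.
by rewrite -[x]mul1mx -(mulmxV uA) -mulmxA -{2}As -trmx_inv Ax mulmx0.
Qed.

Lemma penrose_tr p q (A : 'M[R]_(p, q)) (B : 'M[R]_(q, p)) :
  penrose A B -> penrose A^T B^T.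
Proof.
move=> [ABA BAB AB BA]; split; rewrite -!trmx_mul ?mulmxA ?ABA ?BAB//.
  by rewrite BA.
by rewrite AB.
Qed.

Lemma penrose_uniq p q (A : 'M[R]_(p, q)) (B C : 'M[R]_(q, p)) :
  penrose A B -> penrose A C -> B = C.
Proof.
move=> [ABA BAB AB BA] [ACA CAC AC CA].
have eAB : A *m B = A *m C.
  rewrite -AB -{1}ACA -(mulmxA (A *m C)) trmx_mul AB AC.
  by rewrite mulmxA ABA.
have eBA : B *m A = C *m A.
  rewrite -BA -{1}ACA -mulmxA mulmxA trmx_mul CA BA.
  by rewrite -mulmxA (mulmxA A) ABA.
by rewrite -BAB eBA -mulmxA eAB mulmxA CAC.
Qed.

(** The Penrose conditions are stable under transposition, so this is a
    consequence of their uniqueness. *)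
Lemma mp_pinv_sym p (A : 'M[R]_p) : A^T = A -> (mp_pinv A)^T = mp_pinv A.
Proof.
move=> As; apply: (@penrose_uniq _ _ A); last exact: mp_pinvP.
by rewrite -{1}As; exact/penrose_tr/mp_pinvP.
Qed.

Lemma sym_psd_mp_pinv p (A : 'M[R]_p) : sym_psd A -> sym_psd (mp_pinv A).
Proof.
move=> Apsd; have [_ BAB _ _] := mp_pinvP A.
rewrite -BAB -{2}(mp_pinv_sym Apsd.1); exact: sym_psd_congr.
Qed.

End PsdMatrices.

(** * The Hessian *)

Section Hessian.
Context {R : realType} {n d : nat}.
Variables (H : 'M[R]_(n, d)) (Gamma : 'M[R]_n).
Hypothesis Gamma_pd : sym_pd Gamma.
Local Notation A := (hess H Gamma).

Lemma hessE : A = H^T *m invmx Gamma *m H^T^T.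
Proof. by rewrite trmxK. Qed.

Lemma hess_psd : sym_psd A.
Proof. by rewrite hessE; exact/sym_psd_congr/sym_pd_psd/sym_pd_invmx. Qed.

Lemma hess_sym : A^T = A. Proof. by case: hess_psd. Qed.

Lemma hess_quad_eq0 (x : 'cV[R]_d) : quad_form A x = 0 -> A *m x = 0.
Proof.
rewrite {1}hessE quad_form_congr trmxK => /eqP; apply: contraTeq => Ax.
rewrite gt_eqF//; apply: (sym_pd_invmx Gamma_pd).2.
by apply: contra_neq Ax => Hx; rewrite /hess -mulmxA Hx mulmx0.
Qed.

(** From [x^T A C A x = lam * x^T A x] with both quadratic forms nonnegative;
    when the second one vanishes, so does [A x], and [lam] is zero. *)
Lemma eigen_mul_hess_ge0 (C : 'M[R]_d) (x : 'cV[R]_d) (lam : R) :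
  sym_psd C -> x != 0 -> C *m A *m x = lam *: x -> 0 <= lam.
Proof.
move=> [_ C0] x0 Cx.
have qE : quad_form C (A *m x) = lam * quad_form A x.
  rewrite /quad_form trmx_mul hess_sym -mulmxA (mulmxA C) Cx.
  by rewrite -scalemxAr mxE.
have := hess_psd.2 x; rewrite le_eqVlt => /predU1P[/esym/hess_quad_eq0 Ax|q0].
  have /eqP := Cx; rewrite -mulmxA Ax mulmx0 eq_sym scaler_eq0 (negbTE x0) orbF.
  by move=> /eqP ->.
by rewrite -(pmulr_lge0 _ q0) -qE.
Qed.

(** This is the covariance of [Hplus *m eps], and explains the pseudoinverse in
    the covariance update. *)
Lemma Hplus_Gamma : Hplus H Gamma *m Gamma *m (Hplus H Gamma)^T = mp_pinv A.
Proof.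
have [Gs _] := Gamma_pd; have uG := sym_pd_unitmx Gamma_pd.
rewrite /Hplus !trmx_mul trmxK trmx_inv Gs (mp_pinv_sym hess_sym).
rewrite -(mulmxA _ (invmx Gamma) Gamma) mulVmx// mulmx1.
have [_ BAB _ _] := mp_pinvP A.
by rewrite -[RHS]BAB {2}/hess !mulmxA.
Qed.

End Hessian.

(** * The scalar recursion of an eigendirection *)

Section ContractionFactors.
Context {R : realType}.
Variables lam m : nat -> R.
Hypothesis lam_ge0 : forall i, 0 <= lam i.
Hypothesis m0 : m 0 = 1.
Hypothesis mS : forall i, m i.+1 = m i / (1 + lam i).
Hypothesis lamS :
  forall i, lam i.+1 = m i.+1 ^+ 2 * lam 0%N + (1 - m i.+1) ^+ 2.

Let lam1_gt0 i : 0 < 1 + lam i. Proof. exact: ltr_wpDr. Qed.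

Lemma factor_gt0 i : 0 < m i.
Proof. by elim: i => [|i IH]; rewrite ?m0// mS divr_gt0. Qed.

Lemma factor_le i : m i.+1 <= m i.
Proof. by rewrite mS ler_pdivrMr// ler_peMr ?(ltW (factor_gt0 _))// lerDl. Qed.

Lemma factor_eq1 : lam 0%N = 0 -> forall i, m i = 1.
Proof.
move=> l0 i; suff [] : m i = 1 /\ lam i = 0 by [].
elim: i => [//|i [mi li]].
have mi1 : m i.+1 = 1 by rewrite mS mi li addr0 divr1.
by split=> //; rewrite lamS mi1 l0 mulr0 subrr expr0n add0r.
Qed.

Lemma lam1_gt0E : (0 < lam 1%N) = (lam 0%N != 0).
Proof.
have [l0|l0] := eqVneq (lam 0%N) 0.
  by rewrite lamS factor_eq1// l0 mulr0 subrr expr0n addr0 ltxx.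
rewrite lamS ltr_wpDr ?sqr_ge0// mulr_gt0 ?exprn_gt0 ?factor_gt0//.
by rewrite lt_def l0 lam_ge0.
Qed.

(** Once [m] has dropped below 1, the term [(1 - m) ^+ 2] keeps the eigenvalues
    away from 0, so that the factors decay at least geometrically. *)
Lemma factor_cvg0 : lam 0%N != 0 -> m i @[i --> \oo] --> 0.
Proof.
move=> l0; have l0_gt0 : 0 < lam 0%N by rewrite lt_def l0 lam_ge0.
have m1_lt1 : m 1%N < 1 by rewrite mS m0 div1r invf_lt1// ltrDl.
have m_le1 i : m i.+1 <= m 1%N.
  by elim: i => [//|i]; exact/le_trans/factor_le.
pose q := (1 + (1 - m 1%N) ^+ 2)^-1.
have c_gt0 : 0 < (1 - m 1%N) ^+ 2 by rewrite exprn_gt0// subr_gt0.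
have q_gt0 : 0 < q by rewrite invr_gt0 addr_gt0.
have lam_ge i : (1 - m 1%N) ^+ 2 <= lam i.+1.
  rewrite lamS; apply: ler_wpDl; first by rewrite mulr_ge0 ?sqr_ge0.
  have mi1 : m i.+1 <= 1 by exact: le_trans (m_le1 i) (ltW m1_lt1).
  by rewrite ler_sqr ?nnegrE ?subr_ge0 ?(ltW m1_lt1)// lerD2l lerN2.
have m_le i : m i.+1 <= q ^+ i.
  elim: i => [|i IH]; first by rewrite expr0 ltW.
  rewrite mS exprSr; apply: ler_pM => //; first exact/ltW/factor_gt0.
    by rewrite invr_ge0 ltW.
  by rewrite lef_pV2 ?posrE ?lerD2l// addr_gt0.
rewrite -cvg_shiftS; apply: (@squeeze_cvgr _ _ _ _ (cst 0) (fun i => q ^+ i)).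
- by near=> i; rewrite ltW ?factor_gt0//=.
- exact: cvg_cst.
- by apply: cvg_expr; rewrite gtr0_norm// invf_lt1 ?ltrDl// addr_gt0.
Unshelve. all: by end_near. Qed.

End ContractionFactors.

(** * The iteration in the common eigenbasis *)

Section CommonEigenbasis.
Context {R : comUnitRingType} {d : nat}.
Implicit Types (A B C M W E D : 'M[R]_d) (e : 'rV[R]_d).

(** Both sides of [G *m D = D *m G], for [G] the Gram matrix [W^T A W] of the
    eigenvectors and [D] the diagonal matrix of eigenvalues, are [W^T A C A W]. *)
Lemma gram_eigen_comm A C W e (G := W^T *m A *m W) :
    A^T = A -> C^T = C -> C *m A *m W = W *m diag_mx e ->
  G *m diag_mx e = diag_mx e *m G.
Proof.
move=> As Cs CAW; rewrite /G -!mulmxA -CAW -[X in _ = X *m _]tr_diag_mx !mulmxA.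
by rewrite -[_ *m W^T]trmx_mul -CAW !trmx_mul As Cs !mulmxA.
Qed.

(** [W^T M^T A W] and [W^T A M W] are the two products of the Gram matrix with
    the diagonal form of [M]. *)
Lemma trmx_gram_comm A M W e (G := W^T *m A *m W) :
    W \in unitmx -> M *m W = W *m diag_mx e ->
    G *m diag_mx e = diag_mx e *m G ->
  M^T *m A *m W = A *m W *m diag_mx e.
Proof.
move=> uW MW Ge; have uWT : W^T \in unitmx by rewrite unitmx_tr.
apply: (can_inj (mulKmx uWT)).
rewrite !mulmxA -trmx_mul MW trmx_mul tr_diag_mx.
by move: Ge; rewrite /G !mulmxA.
Qed.

Lemma cov_update_eigen A B C M W D E :
    M *m W = W *m E -> M^T *m A *m W = A *m W *m E ->
    (1%:M - M) *m B *m A = 1%:M - M -> C *m A *m W = W *m D ->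
  (M *m C *m M^T + (1%:M - M) *m B *m (1%:M - M)^T) *m A *m W =
  W *m (E *m D *m E + (1%:M - E) *m (1%:M - E)).
Proof.
move=> MW MT IMA CAW; set I := 1%:M : 'M[R]_d in IMA *.
have IMT : (I - M)^T *m A *m W = A *m W *m (I - E).
  by rewrite raddfB /= trmx1 !mulmxBl MT mulmxBr mulmx1 mul1mx.
have IMW : (I - M) *m W = W *m (I - E).
  by rewrite mulmxBl mulmxBr MW mulmx1 mul1mx.
rewrite [(_ + _) *m A]mulmxDl [(_ + _) *m W]mulmxDl mulmxDr; congr (_ + _).
  rewrite -!mulmxA [M^T *m _]mulmxA MT !mulmxA.
  by rewrite -(mulmxA M) -(mulmxA M) CAW !mulmxA MW.
by rewrite -!mulmxA [_^T *m _]mulmxA IMT !mulmxA IMA IMW.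
Qed.

End CommonEigenbasis.

Section Spectral.
Context {R : realType} {n d : nat}.
Variables (H : 'M[R]_(n, d)) (Gamma : 'M[R]_n) (C0 : 'M[R]_d).
Hypothesis Gamma_pd : sym_pd Gamma.
Hypothesis C0_psd : sym_psd C0.
Local Notation A := (hess H Gamma).
Local Notation C := (mf_cov H Gamma C0).
Local Notation Mprod i := (mf_state H Gamma C0 i).2.

Lemma mf_stateS2 i : Mprod i.+1 = invmx (1%:M + C i *m A) *m Mprod i.
Proof. by rewrite /mf_cov /=; case: (mf_state _ _ _ i). Qed.

Lemma mf_covS i (M := Mprod i.+1) :
  C i.+1 = M *m C0 *m M^T + (1%:M - M) *m mp_pinv A *m (1%:M - M)^T.
Proof. by rewrite /M /mf_cov /=; case: (mf_state _ _ _ i). Qed.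

(** This keeps the eigenvalues nonnegative, hence every step invertible. *)
Lemma mf_cov_psd i : sym_psd (C i).
Proof.
case: i => [//|i]; rewrite mf_covS.
by apply: sym_psdD; apply: sym_psd_congr => //; exact/sym_psd_mp_pinv/hess_psd.
Qed.

Variables (W : 'M[R]_d) (lambda : nat -> 'I_d -> R).
Hypothesis W_basis : W \in unitmx.
Hypothesis W_eigen : forall i l, C i *m A *m col l W = lambda i l *: col l W.

(** The eigenvalue of [M_(i-1) ... M_0] on the direction [l]. *)
Definition mf_factor i l : R := \prod_(k < i) (1 + lambda k l)^-1.

Local Notation D i := (diag_mx (\row_l lambda i l)).
Local Notation E i := (diag_mx (\row_l mf_factor i l)).
Local Notation G := (W^T *m A *m W).

Lemma lambda_ge0 i l : 0 <= lambda i l.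
Proof.
apply: (eigen_mul_hess_ge0 Gamma_pd (mf_cov_psd i) _ (W_eigen i l)).
apply: contraTneq W_basis => Wl.
rewrite unitmxE unitfE negbK (expand_det_col _ l) big1// => k _.
by have /matrixP/(_ k 0) := Wl; rewrite !mxE => ->; rewrite mul0r.
Qed.

Lemma mul_cov_hess_W i : C i *m A *m W = W *m D i.
Proof.
apply/matrixP => k l; have /matrixP/(_ k 0) := W_eigen i l.
by rewrite colE mulmxA -!colE mul_mx_diag !mxE mulrC.
Qed.

Let lambda1_gt0 i l : 0 < 1 + lambda i l.
Proof. by rewrite ltr_wpDr ?lambda_ge0. Qed.

Let mul_step_W i :
  (1%:M + C i *m A) *m (W *m diag_mx (\row_l (1 + lambda i l)^-1)) = W.
Proof.
apply/matrixP => k l.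
rewrite mulmxDl mul1mx mulmxA mul_cov_hess_W !mul_mx_diag !mxE.
by rewrite -mulrDl -{1}[W k l]mulr1 -mulrDr mulfK// gt_eqF.
Qed.

Lemma step_unitmx i : 1%:M + C i *m A \in unitmx.
Proof.
have /mulmx1_unit[]// : (1%:M + C i *m A) *m
  (W *m diag_mx (\row_l (1 + lambda i l)^-1) *m invmx W) = 1%:M.
by rewrite mulmxA mul_step_W mulmxV.
Qed.

Lemma mul_mf_prod_W i : Mprod i *m W = W *m E i.
Proof.
elim: i => [|i IH].
  apply/matrixP => k l; rewrite [Mprod 0]/= mul1mx mul_mx_diag !mxE.
  by rewrite /mf_factor big_ord0 mulr1.
rewrite mf_stateS2 -mulmxA IH mulmxA -{1}(mul_step_W i).
rewrite mulKmx ?step_unitmx//.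
apply/matrixP => k l; rewrite !mul_mx_diag !mxE /mf_factor big_ord_recr /=.
by rewrite mulrAC mulrA.
Qed.

(** Each step [1 + C_i A] is the identity on the kernel of [A]. *)
Lemma mul_mf_prod_ker p (K : 'M[R]_(d, p)) i : A *m K = 0 -> Mprod i *m K = K.
Proof.
move=> AK; elim: i => [|i IH]; first by rewrite [Mprod 0]/= mul1mx.
have step : (1%:M + C i *m A) *m K = K.
  by rewrite mulmxDl mul1mx -mulmxA AK mulmx0 addr0.
by rewrite mf_stateS2 -mulmxA IH -{1}step mulKmx// step_unitmx.
Qed.

(** Entry [k, l] of the commutation of [G] with [D i]. *)
Lemma gram_eigen i k l : G k l != 0 -> lambda i k = lambda i l.
Proof.
move=> Gkl; have := gram_eigen_comm (hess_sym H Gamma_pd) (mf_cov_psd i).1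
  (mul_cov_hess_W i).
move: G Gkl => g gkl /matrixP/(_ k l).
by rewrite mul_mx_diag mul_diag_mx !mxE mulrC => /(mulIf gkl).
Qed.

Lemma gram_factor i k l : G k l != 0 -> mf_factor i k = mf_factor i l.
Proof. by move=> Gkl; apply: eq_bigr => j _; rewrite (gram_eigen j Gkl). Qed.

Lemma mf_prod_hess_sym i : (Mprod i)^T *m A *m W = A *m W *m E i.
Proof.
apply: (trmx_gram_comm W_basis (mul_mf_prod_W i)).
apply/matrixP => k l; have := @gram_factor i k l.
move: G => g; rewrite mul_diag_mx mul_mx_diag !mxE.
have [->|_ ->//] := eqVneq (g k l) 0; first by rewrite mulr0 mul0r.
by rewrite mulrC.
Qed.

(** The covariance update read on one eigendirection: transposing [M] across [A]
    produces the squares, and the pseudoinverse cancels because [1 - M] vanishes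
    on the kernel of [A]. *)
Lemma mf_eigenvalueS i l : lambda i.+1 l =
  mf_factor i.+1 l ^+ 2 * lambda 0%N l + (1 - mf_factor i.+1 l) ^+ 2.
Proof.
set M := Mprod i.+1; set I := 1%:M : 'M[R]_d.
have IMA : (I - M) *m mp_pinv A *m A = I - M.
  have [AA _ _ _] := mp_pinvP A.
  have /(mul_mf_prod_ker i.+1) : A *m (I - mp_pinv A *m A) = 0.
    by rewrite mulmxBr mulmx1 mulmxA AA subrr.
  rewrite -/M => MK; apply/esym/eqP; rewrite -subr_eq0 -mulmxA.
  by rewrite -{1}[I - M]mulmx1 -mulmxBr mulmxBl mul1mx MK subrr.
have := cov_update_eigen (mul_mf_prod_W i.+1) (mf_prod_hess_sym i.+1) IMA
  (mul_cov_hess_W 0).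
rewrite -mf_covS mul_cov_hess_W.
move/(can_inj (mulKmx W_basis))/matrixP/(_ l l).
rewrite mul_mx_diag mul_diag_mx !mxE eqxx !mulr1n => ->.
rewrite (bigD1 l)//= big1 => [|k kl]; last first.
  by rewrite !mxE eq_sym (negbTE kl) mulr0n subrr mul0r.
by rewrite !mxE eqxx !mulr1n addr0 expr2 mulrAC.
Qed.

End Spectral.

(** * Limits of matrices *)

Section MatrixLimits.

Lemma cvg_mxP {T : Type} {U : topologicalType} m n (F : set_system T)
    {FF : Filter F} (M : T -> 'M[U]_(m, n)) (L : 'M[U]_(m, n)) :
  (forall i j, M x i j @[x --> F] --> L i j) -> M x @[x --> F] --> L.
Proof.
move=> ML B [P LP PB].
have FP : F [set x | forall i j, P i j (M x i j)].
  apply: filter_forall => i; apply: filter_forall => j.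
  exact: ML (LP i j).
by apply: (@filterS _ F FF _ (M @^-1` B) _ FP) => x Px; exact: PB.
Qed.

Context {R : realType} {T : Type} (F : set_system T) {FF : Filter F}.

Lemma cvg_coord m n (M : T -> 'M[R]_(m, n)) (L : 'M[R]_(m, n)) :
  M x @[x --> F] --> L -> forall i j, M x i j @[x --> F] --> L i j.
Proof.
by move=> ML i j; exact: (continuous_cvg _ (@coord_continuous _ _ _ i j L) ML).
Qed.

Lemma cvg_map_mx_EFin m n (M : T -> 'M[R]_(m, n)) (L : 'M[R]_(m, n)) :
  M x @[x --> F] --> L -> map_mx EFin (M x) @[x --> F] --> map_mx EFin L.
Proof.
move=> ML; apply: cvg_mxP => i j; rewrite mxE.
under eq_fun do rewrite mxE.
by apply: cvg_EFin; [exact: nearW|exact: cvg_coord].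
Qed.

Lemma cvg_sumr (I : Type) (s : seq I) (f : I -> T -> R) (l : I -> R) :
    (forall i, f i x @[x --> F] --> l i) ->
  \sum_(i <- s) f i x @[x --> F] --> \sum_(i <- s) l i.
Proof.
move=> fl; elim: s => [|i s IH].
  by rewrite big_nil; under eq_fun do rewrite big_nil; exact: cvg_cst.
by rewrite big_cons; under eq_fun do rewrite big_cons; exact: cvgD.
Qed.

Lemma cvg_mulmx m n p (M : T -> 'M[R]_(m, n)) (N : T -> 'M[R]_(n, p))
    (L : 'M[R]_(m, n)) (K : 'M[R]_(n, p)) :
    M x @[x --> F] --> L -> N x @[x --> F] --> K ->
  M x *m N x @[x --> F] --> L *m K.
Proof.
move=> ML NK; apply: cvg_mxP => i j; rewrite mxE.
under eq_fun do rewrite mxE.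
by apply: cvg_sumr => k; apply: cvgM; exact: cvg_coord.
Qed.

Lemma cvg_trmx m n (M : T -> 'M[R]_(m, n)) (L : 'M[R]_(m, n)) :
  M x @[x --> F] --> L -> (M x)^T @[x --> F] --> L^T.
Proof.
move=> ML; apply: cvg_mxP => i j; rewrite mxE.
by under eq_fun do rewrite mxE; apply: cvg_coord.
Qed.

Lemma cvg_diag_mx n (e : T -> 'rV[R]_n) (e' : 'rV[R]_n) :
    (forall l, e x 0 l @[x --> F] --> e' 0 l) ->
  diag_mx (e x) @[x --> F] --> diag_mx e'.
Proof.
move=> ee; apply: cvg_mxP => i j; rewrite mxE.
under eq_fun do rewrite mxE.
by case: (i == j); [exact: ee|exact: cvg_cst].
Qed.

(** A particle and its mean are mixtures of this form, with [M] the product of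
    the contractions; the next lemma treats the covariance. *)
Lemma cvg_affine_mix m n (M : T -> 'M[R]_m) (L : 'M[R]_m) (a b : 'M[R]_(m, n)) :
    M x @[x --> F] --> L ->
  M x *m a + (1%:M - M x) *m b @[x --> F] --> L *m a + (1%:M - L) *m b.
Proof.
move=> ML; apply: cvgD; apply: cvg_mulmx => //; try exact: cvg_cst.
by apply: cvgB => //; exact: cvg_cst.
Qed.

Lemma cvg_congr_mix m (M : T -> 'M[R]_m) (L a b : 'M[R]_m) :
    M x @[x --> F] --> L ->
  M x *m a *m (M x)^T + (1%:M - M x) *m b *m (1%:M - M x)^T @[x --> F] -->
  L *m a *m L^T + (1%:M - L) *m b *m (1%:M - L)^T.
Proof.
move=> ML; have NK : 1%:M - M x @[x --> F] --> 1%:M - L.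
  by apply: cvgB => //; exact: cvg_cst.
by apply: cvgD; apply: cvg_mulmx; (try exact: cvg_trmx); apply: cvg_mulmx => //;
  exact: cvg_cst.
Qed.

End MatrixLimits.

(** * Limit of the product of contractions *)

Section SpectralLimit.
Context {R : realType} {n d : nat}.
Variables (H : 'M[R]_(n, d)) (Gamma : 'M[R]_n) (C0 : 'M[R]_d).
Hypothesis Gamma_pd : sym_pd Gamma.
Hypothesis C0_psd : sym_psd C0.
Local Notation A := (hess H Gamma).
Local Notation C := (mf_cov H Gamma C0).
Variables (W : 'M[R]_d) (lambda : nat -> 'I_d -> R).
Hypothesis W_basis : W \in unitmx.
Hypothesis W_eigen : forall i l, C i *m A *m col l W = lambda i l *: col l W.
Variables (r : nat) (le_rd : (r <= d)%N).
Hypothesis r_count : #|[set l : 'I_d | 0 < lambda 1%N l]%SET| = r.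
Hypothesis lambda_pos : forall l : 'I_d, (l < r)%N -> 0 < lambda 1%N l.
Local Notation U := (colsub (widen_ord le_rd) W).
Hypothesis U_norm : U^T *m A *m U = 1%:M.

Let lam_ge0 l i : 0 <= lambda i l.
Proof. exact: lambda_ge0 W_eigen _ _. Qed.

Let factor0 l : mf_factor lambda 0 l = 1.
Proof. by rewrite /mf_factor big_ord0. Qed.

Let factorS l i :
  mf_factor lambda i.+1 l = mf_factor lambda i l / (1 + lambda i l).
Proof. by rewrite /mf_factor big_ord_recr. Qed.

Let lamS l i := mf_eigenvalueS Gamma_pd C0_psd W_basis W_eigen i l.

(** The indexing puts the [r] positive eigenvalues of step 1 first; by the
    recursion they are the nonzero ones of step 0. *)
Lemma lambda0_neq0 l : (lambda 0%N l != 0) = (l < r)%N.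
Proof.
rewrite -(lam1_gt0E (lam_ge0 l) (factor0 l) (factorS l) (lamS l)).
pose X : {set 'I_d} := finset (fun k : 'I_d => (k < r)%N).
pose Y : {set 'I_d} := finset (fun k : 'I_d => 0 < lambda 1%N k).
have card_X : #|X| = r.
  have -> : X = [set widen_ord le_rd k | k : 'I_r]%SET.
    apply/setP => k; rewrite inE; apply/idP/imsetP => [kr|[j _ ->]].
      by exists (Ordinal kr) => //; exact: val_inj.
    exact: (ltn_ord j).
  by rewrite card_imset ?card_ord// => i j /(congr1 val)/= /val_inj.
have /eqP/setP/(_ l) : X == Y.
  rewrite eqEcard card_X r_count leqnn andbT.
  by apply/fintype.subsetP => k; rewrite !inE => /lambda_pos.
by rewrite !inE.
Qed.

Lemma mf_factor_cvg l : mf_factor lambda i l @[i --> \oo] --> ((r <= l)%N%:R : R).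
Proof.
rewrite leqNgt -lambda0_neq0 negbK.
have [l0|l0] := eqVneq (lambda 0%N l) 0.
  under eq_fun do rewrite (factor_eq1 (factor0 l) (factorS l) (lamS l) l0).
  exact: cvg_cst.
exact: factor_cvg0 (lam_ge0 l) (factor0 l) (factorS l) (lamS l) l0.
Qed.

(** [U U^T A] is the spectral projector: the columns of [U] are orthonormal for
    [A], and [A]-orthogonal to the other eigenvectors since those have another
    eigenvalue. *)
Lemma projector_mulW : U *m U^T *m A *m W = W *m diag_mx (\row_l (l < r)%N%:R).
Proof.
have UAW (k : 'I_r) (l : 'I_d) :
    (U^T *m A *m W) k l = (widen_ord le_rd k == l)%:R.
  have [lr|rl] := ltnP l r.
    have -> : l = widen_ord le_rd (Ordinal lr) by exact: val_inj.
    have /matrixP/(_ k (Ordinal lr)) := U_norm.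
    rewrite [RHS]mxE -(inj_eq val_inj) => <-.
    by rewrite mulmx_colsub [RHS]mxE.
  have -> : (widen_ord le_rd k == l) = false.
    by apply/eqP => kl; move: rl; rewrite -kl leqNgt (ltn_ord k).
  have -> : (U^T *m A *m W) k l = (W^T *m A *m W) (widen_ord le_rd k) l.
    have -> : U^T = rowsub (widen_ord le_rd) W^T.
      by apply/matrixP => ? ?; rewrite !mxE.
    by rewrite !mul_rowsub_mx mxE.
  apply/eqP; apply: contraTT rl => /(gram_eigen Gamma_pd C0_psd W_eigen 0) e.
  by rewrite -ltnNge -lambda0_neq0 -e lambda0_neq0 (ltn_ord k).
have -> : U *m U^T *m A *m W = U *m (U^T *m A *m W) by rewrite !mulmxA.
apply/matrixP => i l; rewrite [LHS]mxE mul_mx_diag ![in RHS]mxE.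
under eq_bigr do rewrite UAW mxE.
have [lr|rl] := ltnP l r.
  rewrite (bigD1 (Ordinal lr))//= big1 => [|k kl].
    have -> : widen_ord le_rd (Ordinal lr) = l by exact: val_inj.
    by rewrite eqxx addr0.
  rewrite -val_eqE/= -[l : nat]/(val (Ordinal lr)).
  by rewrite val_eqE (negbTE kl) mulr0.
rewrite mulr0 big1// => k _.
have -> : (widen_ord le_rd k == l) = false; last by rewrite mulr0.
by apply/eqP => kl; move: rl; rewrite -kl leqNgt (ltn_ord k).
Qed.

Lemma mf_prod_cvg : mf_prod H Gamma C0 i @[i --> \oo] --> 1%:M - U *m U^T *m A.
Proof.
rewrite /mf_prod (@cvg_shiftS _ (fun i => (mf_state H Gamma C0 i).2)).
have -> : 1%:M - U *m U^T *m A = W *m diag_mx (\row_l (r <= l)%N%:R) *m invmx W.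
  rewrite -[LHS](mulmxK W_basis) mulmxBl mul1mx projector_mulW; congr (_ *m _).
  apply/matrixP => k l; rewrite !mul_mx_diag !mxE [(r <= l)%N]leqNgt.
  by case: (l < r)%N; rewrite /= ?mulr1 ?mulr0 ?subrr ?subr0.
have ME i : (mf_state H Gamma C0 i).2 =
    W *m diag_mx (\row_l mf_factor lambda i l) *m invmx W.
  by rewrite -(mul_mf_prod_W Gamma_pd C0_psd W_basis W_eigen) mulmxK.
under eq_fun do rewrite ME.
apply: cvg_mulmx; last exact: cvg_cst.
apply: cvg_mulmx; first exact: cvg_cst.
apply: cvg_diag_mx => l; rewrite mxE; under eq_fun do rewrite mxE.
exact: mf_factor_cvg.
Qed.

End SpectralLimit.

(** * Second moment of the normal law *)

Section NormalSecondMoment.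
Context {R : realType}.
Local Notation mu := (@lebesgue_measure R).
Variable s : R.
Hypothesis s0 : s != 0.
Local Notation p := (normal_pdf 0 s).

Let f x := x ^+ 2 * p x.

Lemma normal_pdf_even x : p (- x) = p x.
Proof. by rewrite !normal_pdfE// /normal_fun !subr0 sqrrN. Qed.

Let cp : continuous p. Proof. exact: continuous_normal_pdf. Qed.

Let cf : continuous f.
Proof.
by move=> x; apply: cvgM; [exact: exprn_continuous|exact: cp].
Qed.

Let f_ge0 x : 0 <= f x.
Proof. by rewrite mulr_ge0 ?sqr_ge0 ?normal_pdf_ge0. Qed.

Let h x := p x - s ^- 2 * f x.

Let ch : continuous h.
Proof.
move=> x; apply: cvgB; first exact: cp.
by apply: cvgM; [exact: cvg_cst|exact: cf].
Qed.

Lemma is_derive_xnormal_pdf (x : R) : is_derive x 1 (fun x => x * p x) (h x).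
Proof.
rewrite /h /f normal_pdfE// /normal_fun; apply: is_derive_eq.
rewrite /GRing.scale/= !subr0; set e := expR _.
rewrite -mulr_natr; move: e (normal_peak s) => e c.
by field; rewrite s0.
Qed.

(** Integration by parts, in the form that [x * p x] is a primitive of
    [p x - x ^+ 2 * p x / s ^+ 2]. *)
Lemma integral_0n_sqr_normal_pdf n :
  (\int[mu]_(x in `[0%R, n.+1%:R%R]) (f x)%:E =
   (s ^+ 2)%:E * (\int[mu]_(x in `[0%R, n.+1%:R%R]) (p x)%:E) -
   (s ^+ 2 * (n.+1%:R * p n.+1%:R))%:E)%E.
Proof.
have int (g : R -> R) : continuous g ->
    mu.-integrable `[0%R, n.+1%:R%R] (EFin \o g).
  move=> cg; apply: continuous_compact_integrable; first exact: segment_compact.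
  exact: continuous_subspaceT.
have FTC : (\int[mu]_(x in `[0%R, n.+1%:R%R]) (h x)%:E =
    (n.+1%:R * p n.+1%:R)%:E)%E.
  rewrite (@continuous_FTC2 _ _ (fun x => x * p x))//.
  - by rewrite mul0r sube0.
  - exact: continuous_subspaceT.
  - have cF : continuous (fun x : R => x * p x).
      by move=> x; apply: cvgM => //; exact: cp.
    split=> [x _| |].
    + by have [] := is_derive_xnormal_pdf x.
    + exact/cvg_at_right_filter/cF.
    + exact/cvg_at_left_filter/cF.
  - move=> x _; rewrite derive1E.
    exact: (@derive_val _ _ _ _ _ _ _ (is_derive_xnormal_pdf x)).
have fE x : f x = s ^+ 2 * p x - s ^+ 2 * h x.
  by rewrite /h; field; rewrite s0.
under eq_integral do rewrite fE EFinB !EFinM.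
rewrite integralB//=; last 2 first.
- exact/integrableZl/int.
- exact/integrableZl/int.
rewrite !integralZl//; try exact: int.
by rewrite FTC EFinM.
Qed.

(** The boundary term vanishes: [expR (- u) <= u^-1], with [u] quadratic in [x],
    beats the factor [x]. *)
Lemma cvg_xnormal_pdf : n.+1%:R * p n.+1%:R @[n --> \oo] --> 0.
Proof.
pose c := normal_peak s * (s ^+ 2 *+ 2).
apply: (@squeeze_cvgr _ _ _ _ (cst 0) (fun n => c * harmonic n)).
- near=> n; rewrite mulr_ge0 ?normal_pdf_ge0//= /c -mulrA normal_pdfE//.
  rewrite mulrCA ler_pM2l ?normal_peak_gt0// /normal_fun subr0 mulNr expRN.
  set x := n.+1%:R; have x0 : 0 < x :> R by rewrite ltr0n.
  have s20 : 0 < s ^+ 2 *+ 2 by rewrite pmulrn_lgt0// exprn_even_gt0.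
  have u0 : 0 < x ^+ 2 / (s ^+ 2 *+ 2) by rewrite divr_gt0 ?exprn_gt0.
  apply: (@le_trans _ _ (x * (x ^+ 2 / (s ^+ 2 *+ 2))^-1)).
    rewrite ler_pM2l// lef_pV2 ?posrE ?expR_gt0//.
    by apply: le_trans (expR_ge1Dx _); rewrite lerDr.
  rewrite -/x le_eqVlt; apply/predU1l; rewrite invf_div.
  by field; rewrite gt_eqF.
- exact: cvg_cst.
- rewrite -[X in _ --> X](mulr0 c); apply: cvgM; first exact: cvg_cst.
  exact: cvg_harmonic.
Unshelve. all: by end_near. Qed.

Lemma integral_sqr_normal_pdf :
  (\int[mu]_x (x ^+ 2 * p x)%:E = (s ^+ 2)%:E)%E.
Proof.
have half (g : R -> R) : (forall x, 0 <= g x) -> continuous g ->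
    (forall x, g (- x) = g x) ->
    (\int[mu]_x (g x)%:E = 2%:E * \int[mu]_(x in `[0%R, +oo[) (g x)%:E)%E.
  move=> g0 cg eg; rewrite ge0_symfun_integralT//; last first.
    by move=> x; rewrite /= eg.
  by rewrite set_itvcy.
have mf (g : R -> R) : continuous g -> measurable_fun setT g.
  exact: measurable_realfun.continuous_measurable_fun.
have lim_p : (\int[mu]_(x in `[0%R, n.+1%:R%R]) (p x)%:E @[n --> \oo] -->
    \int[mu]_(x in `[0%R, +oo[) (p x)%:E)%E.
  have := @ge0_cvgn_integral R mu p (@normal_pdf_ge0 R 0 s) (mf _ cp).
  by rewrite -(cvg_shiftS (fun n => \int[mu]_(x in `[0%R, n%:R%R]) (p x)%:E)%E).
have lim_f : (\int[mu]_(x in `[0%R, n.+1%:R%R]) (f x)%:E @[n --> \oo] -->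
    \int[mu]_(x in `[0%R, +oo[) (f x)%:E)%E.
  have := @ge0_cvgn_integral R mu f f_ge0 (mf _ cf).
  by rewrite -(cvg_shiftS (fun n => \int[mu]_(x in `[0%R, n%:R%R]) (f x)%:E)%E).
have p2 : (\int[mu]_(x in `[0%R, +oo[) (p x)%:E = 2^-1%:E)%E.
  have := integral_normal_pdf 0 s.
  rewrite half//; [|exact: normal_pdf_ge0|exact: normal_pdf_even].
  case: (\int[mu]_(x in `[0%R, +oo[) (p x)%:E)%E => [a| |].
  - by rewrite -EFinM => -[a1]; congr EFin; lra.
  - by rewrite gt0_muley.
  - by rewrite gt0_muleNy.
have f2 : (\int[mu]_(x in `[0%R, +oo[) (f x)%:E = (s ^+ 2 * 2^-1)%:E)%E.
  move: lim_f; rewrite (funext integral_0n_sqr_normal_pdf) => lim_f.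
  apply: (cvg_unique _ lim_f) => //.
  rewrite (_ : (s ^+ 2 * 2^-1)%:E =
      ((s ^+ 2)%:E * 2^-1%:E - (s ^+ 2 * 0)%:E)%E); last first.
    by rewrite mulr0 sube0 EFinM.
  apply: cvgeB => //; first by apply: cvgeZl => //; rewrite -p2.
  apply: cvg_EFin; first exact: nearW.
  by apply: cvgM; [exact: cvg_cst|exact: cvg_xnormal_pdf].
rewrite half//; last by move=> x; rewrite normal_pdf_even sqrrN.
by rewrite f2 -EFinM; congr EFin; field.
Qed.

End NormalSecondMoment.

Section NormalIntegral.
Context {R : realType}.
Local Notation mu := (@lebesgue_measure R).
Local Open Scope ereal_scope.

(** The density agrees almost everywhere with the Radon-Nikodym derivative, so
    this is the change of variables for the latter. *)
Lemma ge0_integral_normal_prob (m s : R) (g : R -> \bar R) :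
    measurable_fun setT g -> (forall x, 0 <= g x) ->
  \int[normal_prob m s]_x g x = \int[mu]_x (g x * (normal_pdf m s x)%:E).
Proof.
move=> mg g0; have dom := normal_prob_dominates m s.
have mpdf : measurable_fun setT (fun x => (normal_pdf m s x)%:E).
  by apply/measurable_EFinP; exact: measurable_normal_pdf.
rewrite -(Radon_Nikodym_SigmaFinite.change_of_variables dom)//.
have iRN := Radon_Nikodym_SigmaFinite.f_integrable dom.
have mRN := measurable_int _ iRN.
apply: ae_eq_integral => //; [exact: emeasurable_funM|exact: emeasurable_funM|].
apply: ae_eqe_mul2l; apply: integral_ae_eq => // E _ mE.
by rewrite -(Radon_Nikodym_SigmaFinite.f_integral dom).
Qed.

Lemma integral_sqr_normal_prob (s : R) : s != 0%R ->
  \int[normal_prob 0%R s]_x (x ^+ 2)%:E = (s ^+ 2)%:E.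
Proof.
move=> s0; rewrite ge0_integral_normal_prob.
- by rewrite -integral_sqr_normal_pdf//; apply: eq_integral => x _; rewrite EFinM.
- by apply/measurable_EFinP; exact: measurable_funX.
- by move=> x; rewrite lee_fin sqr_ge0.
Qed.

End NormalIntegral.

(** * Square-integrable and independent variables *)

Section SquareIntegrable.
Context {d} {T : measurableType d} {R : realType} (P : probability T R).

Lemma Lfun2_of_sqr (X : T -> R) : measurable_fun setT X ->
  (\int[P]_w (X w ^+ 2)%:E < +oo)%E -> X \in Lfun P 2%:E.
Proof.
move=> mX X2; rewrite inE; apply/andP; split; rewrite inE //=.
rewrite /finite_norm unlock /=; apply: poweR_lty.
rewrite (eq_integral (fun w => (X w ^+ 2)%:E))// => w _ /=.
by rewrite powR_mulrn// real_normK// num_real.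
Qed.

Lemma Lfun2_measurable (X : T -> R) : X \in Lfun P 2%:E -> measurable_fun setT X.
Proof. by rewrite inE => /andP[]; rewrite inE. Qed.

Lemma Lfun2_Lfun1 (X : T -> R) : X \in Lfun P 2%:E -> X \in Lfun P 1.
Proof. by apply: Lfun_subset12; exact: fin_num_measure. Qed.

End SquareIntegrable.

Section IndependentProduct.
Context {d} {T : measurableType d} {R : realType} (P : probability T R).
Local Open Scope ereal_scope.

(** The joint law of two independent variables is the product of their laws,
    so the expectation of the product factors by Fubini. *)
Lemma expectation_indepM (X Y : {RV P >-> R}) :
    (X : T -> R) \in Lfun P 2%:E -> (Y : T -> R) \in Lfun P 2%:E ->
    (forall A B : set R, measurable A -> measurable B ->
       P (X @^-1` A `&` Y @^-1` B) = P (X @^-1` A) * P (Y @^-1` B)) ->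
  'E_P[(X : T -> R) * Y] = 'E_P[X] * 'E_P[Y].
Proof.
move=> X2 Y2 XY.
have mZ : measurable_fun setT (fun w => (X w, Y w)) by exact: measurable_fun_pair.
pose Z : {mfun T >-> (R * R)%type} := HB.pack (fun w => (X w, Y w))
  (isMeasurableFun.Build _ _ _ _ _ mZ).
pose muX := distribution P X; pose muY := distribution P Y.
have joint S : measurable S -> (muX \x muY) S = distribution P Z S.
  apply: product_measure_unique => A B mA mB; rewrite /= -XY//.
pose g (z : R * R) : \bar R := (z.1 * z.2)%:E.
have mg : measurable_fun [set: (R * R)%type] g.
  by apply/measurable_EFinP; exact: measurable_funM.
have iXY : P.-integrable setT (g \o Z).
  by have /Lfun1_integrable := Lfun2_mul_Lfun1 X2 Y2.
have iX : P.-integrable setT (EFin \o X).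
  exact/Lfun1_integrable/Lfun2_Lfun1.
have iY : P.-integrable setT (EFin \o Y).
  exact/Lfun1_integrable/Lfun2_Lfun1.
have ig : (muX \x muY).-integrable setT g.
  apply/integrableP; split=> //.
  rewrite (eq_measure_integral (distribution P Z)); last first.
    by move=> A mA _; exact: joint.
  by have /integrableP[] := integrable_pushforward mZ mg iXY measurableT.
have iidX : muX.-integrable setT (EFin : R -> \bar R).
  by apply: integrable_pushforward => //; exact/measurable_EFinP.
have iidY : muY.-integrable setT (EFin : R -> \bar R).
  by apply: integrable_pushforward => //; exact/measurable_EFinP.
transitivity (\int[muX \x muY]_z g z).
  rewrite (eq_measure_integral (distribution P Z)); last first.
    by move=> A mA _; exact: joint.
  by rewrite integral_pushforward// unlock.
rewrite -integral12_prod_meas1// /fubini_F /=.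
have EX : 'E_P[X] = \int[muX]_x x%:E by rewrite integral_pushforward// unlock.
have EY : 'E_P[Y] = \int[muY]_x x%:E by rewrite integral_pushforward// unlock.
have fEY : 'E_P[Y] \is a fin_num.
  by apply: expectation_fin_num; exact: Lfun2_Lfun1.
under eq_integral => x _.
  under eq_integral do rewrite /g EFinM.
  rewrite integralZl// -EY -(fineK fEY).
  over.
by rewrite integralZr// -EX (fineK fEY).
Qed.

Lemma covariance_indep (X Y : {RV P >-> R}) :
    (X : T -> R) \in Lfun P 2%:E -> (Y : T -> R) \in Lfun P 2%:E ->
    (forall A B : set R, measurable A -> measurable B ->
       P (X @^-1` A `&` Y @^-1` B) = P (X @^-1` A) * P (Y @^-1` B)) ->
  covariance P X Y = 0.
Proof.
move=> X2 Y2 XY; have X1 := Lfun2_Lfun1 X2; have Y1 := Lfun2_Lfun1 Y2.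
rewrite covarianceE ?expectation_indepM ?Lfun2_mul_Lfun1//.
by rewrite subee// fin_numM// expectation_fin_num.
Qed.

End IndependentProduct.

(** * Moments of a centred Gaussian vector *)

Section CentredGaussian.
Context {d} {T : measurableType d} {R : realType} (P : probability T R).
Local Open Scope ereal_scope.

Lemma integral_sqr_gaussian1 (X : {RV P >-> R}) (v : R) : (0 <= v)%R ->
    (forall B : set R, measurable B -> P (X @^-1` B) = gaussian1 0 v B) ->
  \int[P]_w (X w ^+ 2)%:E = v%:E.
Proof.
move=> v0 law.
(* The normal law lives on the copy of the line that carries Lebesgue measure. *)
have mX : measurable_fun setT (X : T -> measurableTypeR R).
  exact: (measurable_funPT X).
pose X' : {mfun T >-> measurableTypeR R} := HB.pack (X : T -> measurableTypeR R)
  (isMeasurableFun.Build _ _ _ (measurableTypeR R) _ mX).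
have msq : measurable_fun setT (fun x : measurableTypeR R => (x ^+ 2)%:E).
  by apply/measurable_EFinP; exact: measurable_funX.
have -> : \int[P]_w (X w ^+ 2)%:E = \int[distribution P X']_x (x ^+ 2)%:E.
  rewrite /distribution (ge0_integral_pushforward mX)// => x _.
  by rewrite lee_fin sqr_ge0.
move: law; rewrite /gaussian1; have [->|vn0] := eqVneq v 0%R => law.
  rewrite (eq_measure_integral (\d_(0%R : measurableTypeR R))); last first.
    by move=> A mA _; exact: law.
  by rewrite integral_dirac// expr0n mule0.
rewrite (eq_measure_integral (normal_prob 0%R (Num.sqrt v))); last first.
  by move=> A mA _; exact: law.
have sv0 : Num.sqrt v != 0%R by rewrite sqrtr_eq0 -ltNge lt_def vn0.
by rewrite integral_sqr_normal_prob// sqr_sqrtr.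
Qed.

Lemma expectation_same_law (X Y : {RV P >-> R}) :
    (X : T -> R) \in Lfun P 1 -> (Y : T -> R) \in Lfun P 1 ->
    (forall B : set R, measurable B -> P (X @^-1` B) = P (Y @^-1` B)) ->
  'E_P[X] = 'E_P[Y].
Proof.
move=> /Lfun1_integrable X1 /Lfun1_integrable Y1 law.
rewrite !expectation_def -!(integral_distribution _ _ (f := EFin))//.
by apply: eq_measure_integral => A mA _; exact: law.
Qed.

Context {p : nat} (X : T -> 'cV[R]_p) (S : 'M[R]_p).
Hypothesis S_psd : sym_psd S.
Hypothesis X_gauss : gaussian_vec P X 0 S.

Let form (a : 'cV[R]_p) (w : T) : R := (a^T *m X w)%R 0%R 0%R.

Let measurable_form a : measurable_fun setT (form a).
Proof.
rewrite (_ : form a = fun w => \sum_k (a k 0 * X w k 0))%R; last first.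
  by apply/funext => w; rewrite /form mxE; apply: eq_bigr => k _; rewrite mxE.
apply: measurable_sum => k.
by apply: measurable_funM => //; exact: X_gauss.1.
Qed.

Let rv a : {RV P >-> R} :=
  HB.pack (form a) (isMeasurableFun.Build _ _ _ _ _ (measurable_form a)).

Let law a (B : set R) : measurable B ->
  P (rv a @^-1` B) = gaussian1 0 (quad_form S a) B.
Proof. by move=> mB; rewrite (X_gauss.2 a B mB) mulmx0 mxE. Qed.

Let sqr a : \int[P]_w (form a w ^+ 2)%:E = (quad_form S a)%:E.
Proof. exact: (integral_sqr_gaussian1 (S_psd.2 a) (@law a)). Qed.

Let form2 a : form a \in Lfun P 2%:E.
Proof. by apply: Lfun2_of_sqr => //; rewrite sqr ltry. Qed.

(** The form along [- a] has the same law, and opposite mean. *)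
Let mean_form a : 'E_P[form a] = 0.
Proof.
have formN : form (- a)%R = (\- form a)%R.
  by apply/funext => w; rewrite /form raddfN /= mulNmx mxE.
have := @expectation_same_law (rv (- a)%R) (rv a)
  (Lfun2_Lfun1 (form2 _)) (Lfun2_Lfun1 (form2 _)).
have -> : 'E_P[rv (- a)%R] = - 'E_P[form a].
  rewrite /= formN -[RHS]mulN1e -EFinN -expectationZl ?Lfun2_Lfun1//.
  by congr expectation; apply/funext => w /=; rewrite mulrN1.
have same B : measurable B -> P (rv (- a)%R @^-1` B) = P (rv a @^-1` B).
  have qN : quad_form S (- a)%R = quad_form S a.
    have aT : ((- a)^T = - a^T)%R by rewrite raddfN.
    by rewrite /quad_form aT mulmxN !mulNmx opprK.
  by move=> mB; rewrite (law (- a)%R mB) qN -(law a mB).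
move=> /(_ same).
have := expectation_fin_num (Lfun2_Lfun1 (form2 a)).
rewrite /=; case: ('E_P[form a]) => // e _ [e0].
by congr EFin; lra.
Qed.

Let var_form a : covariance P (form a) (form a) = (quad_form S a)%:E.
Proof.
have := varianceE (form2 a); rewrite /variance => ->.
rewrite mean_form expe2 mul0e sube0 -sqr unlock.
by apply: eq_integral.
Qed.

Let coordE k : (fun w => X w k 0%R) = form (delta_mx k 0%R).
Proof. by apply/funext => w; rewrite /form trmx_delta -rowE mxE. Qed.

Lemma gaussian_square_integrable : square_integrable_vec P X.
Proof. by move=> k; rewrite coordE; exact: form2. Qed.

Lemma gaussian_mean : mean_vec P X = map_mx EFin 0%R.
Proof.
by apply/matrixP => k l; rewrite !mxE ord1 coordE mean_form.
Qed.

(** Polarization: the law of a linear form only yields its variance. *)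
Lemma gaussian_cov : cov_mx P X = map_mx EFin S.
Proof.
apply/matrixP => k l; rewrite !mxE !coordE.
set a := delta_mx k _; set b := delta_mx l _.
have formD : form (a + b)%R = (form a \+ form b)%R.
  by apply/funext => w; rewrite /form raddfD /= mulmxDl mxE.
have := varianceD (form2 a) (form2 b).
rewrite /variance -formD !var_form.
have := covariance_fin_num (Lfun2_Lfun1 (form2 a)) (Lfun2_Lfun1 (form2 b))
  (Lfun2_mul_Lfun1 (form2 a) (form2 b)).
case: (covariance P _ _) => // c _; rewrite -EFinM -!EFinD => -[].
have quadE (i j : 'I_p) :
    ((delta_mx i (0 : 'I_1))^T *m S *m delta_mx j 0)%R 0%R 0%R = S i j.
  rewrite trmx_delta -rowE mxE (bigD1 j)//= big1 => [|k' kj].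
    by rewrite !mxE !eqxx mulr1 addr0.
  by rewrite !mxE (negbTE kj) mulr0.
have bSa : (b^T *m S *m a)%R 0%R 0%R = S k l by rewrite quadE -{1}S_psd.1 mxE.
have abT : ((a + b)^T = a^T + b^T)%R by rewrite raddfD.
rewrite /quad_form abT !mulmxDl !mulmxDr => e; congr EFin; move: e.
rewrite ![fun_of_matrix (_ + _)%R _ _]mxE bSa !quadE; lra.
Qed.

End CentredGaussian.

(** * Moments of affine images *)

Section Moments.
Context {d} {T : measurableType d} {R : realType} (P : probability T R).

Let one_le_two : (1%:E <= 2%:E :> \bar R)%E. Proof. by rewrite lee_fin ler1n. Qed.

Lemma Lfun2D (f g : T -> R) :
  f \in Lfun P 2%:E -> g \in Lfun P 2%:E -> f \+ g \in Lfun P 2%:E.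
Proof. exact: (Lfun_addr_closed P one_le_two).2. Qed.

Let lin_nil (I : Type) (a : I -> R) (f : I -> T -> R) :
  (fun w => \sum_(k <- [::]) a k * f k w) = cst 0.
Proof. by apply/funext => w; rewrite big_nil. Qed.

Let lin_cons (I : Type) i (s : seq I) (a : I -> R) (f : I -> T -> R) :
  (fun w => \sum_(k <- i :: s) a k * f k w) =
  (a i \o* f i) \+ (fun w => \sum_(k <- s) a k * f k w).
Proof. by apply/funext => w; rewrite big_cons /= mulrC. Qed.

Let Lfun2_scale (a : R) (f : T -> R) :
  f \in Lfun P 2%:E -> a \o* f \in Lfun P 2%:E.
Proof. by apply: Lfun_scale; rewrite ler1n. Qed.

Lemma Lfun2_sum (I : Type) (s : seq I) (a : I -> R) (f : I -> T -> R) :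
    (forall i, f i \in Lfun P 2%:E) ->
  (fun w => \sum_(i <- s) a i * f i w) \in Lfun P 2%:E.
Proof.
move=> f2; elim: s => [|i s IH]; first by rewrite lin_nil Lfun_cst.
by rewrite lin_cons; apply: Lfun2D => //; exact: Lfun2_scale.
Qed.

Lemma expectation_lin (I : Type) (s : seq I) (a : I -> R) (f : I -> T -> R)
    (e : I -> R) :
    (forall i, f i \in Lfun P 2%:E) -> (forall i, 'E_P[f i] = (e i)%:E)%E ->
  ('E_P[fun w => (\sum_(i <- s) a i * f i w)%R])%E =
    (\sum_(i <- s) a i * e i)%:E.
Proof.
move=> f2 fe; elim: s => [|i s IH].
  by rewrite lin_nil expectation_cst big_nil.
rewrite lin_cons expectationD ?Lfun2_Lfun1 ?Lfun2_sum ?Lfun2_scale//.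
by rewrite expectationZl ?Lfun2_Lfun1// fe IH big_cons EFinD EFinM.
Qed.

Lemma covariance_lin (I : Type) (s : seq I) (a : I -> R) (f : I -> T -> R)
    (g : T -> R) (c : I -> R) :
    (forall i, f i \in Lfun P 2%:E) -> g \in Lfun P 2%:E ->
    (forall i, covariance P (f i) g = (c i)%:E) ->
  covariance P (fun w => \sum_(i <- s) a i * f i w) g =
    (\sum_(i <- s) a i * c i)%:E.
Proof.
move=> f2 g2 fc; elim: s => [|i s IH].
  by rewrite lin_nil covariance_cst_l big_nil.
rewrite lin_cons covarianceDl ?Lfun2_sum ?Lfun2_scale//.
rewrite (covarianceZl _ (Lfun2_Lfun1 (f2 i)) (Lfun2_Lfun1 g2)
  (Lfun2_mul_Lfun1 (f2 i) g2)).
by rewrite fc IH big_cons EFinD EFinM.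
Qed.

(** With [cross_cov P X X] being [cov_mx P X] by definition, bilinearity can be
    used one argument at a time. *)
Definition cross_cov p q (X : T -> 'cV[R]_p) (Y : T -> 'cV[R]_q) :
    'M[\bar R]_(p, q) :=
  \matrix_(k, l) covariance P (fun w => X w k 0) (fun w => Y w l 0).

Lemma cross_covC p q (X : T -> 'cV[R]_p) (Y : T -> 'cV[R]_q) :
  cross_cov Y X = (cross_cov X Y)^T.
Proof. by apply/matrixP => k l; rewrite !mxE covarianceC. Qed.

Section Affine.
Context {p q : nat} (B : 'M[R]_(q, p)) (b : 'cV[R]_q) (X : T -> 'cV[R]_p).
Hypothesis X2 : square_integrable_vec P X.

Let entryE k : (fun w => (B *m X w + b) k 0) =
  (fun w => \sum_j B k j * X w j 0) \+ cst (b k 0).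
Proof. by apply/funext => w; rewrite !mxE. Qed.

Lemma square_integrable_affine :
  square_integrable_vec P (fun w => B *m X w + b).
Proof.
by move=> k; rewrite entryE; apply: Lfun2D; [exact: Lfun2_sum|exact: Lfun_cst].
Qed.

Lemma mean_vec_affine m : mean_vec P X = map_mx EFin m ->
  mean_vec P (fun w => B *m X w + b) = map_mx EFin (B *m m + b).
Proof.
move=> Xm; apply/matrixP => k l; rewrite ord1 [LHS]mxE [RHS]mxE entryE.
rewrite expectationD ?Lfun2_Lfun1 ?Lfun2_sum ?Lfun_cst// expectation_cst.
rewrite (@expectation_lin _ _ _ _ (fun j => m j 0))//; last first.
  by move=> j; have /matrixP/(_ j 0) := Xm; rewrite !mxE.
by rewrite !mxE.
Qed.

Lemma cross_cov_affine r (Y : T -> 'cV[R]_r) C :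
    square_integrable_vec P Y -> cross_cov X Y = map_mx EFin C ->
  cross_cov (fun w => B *m X w + b) Y = map_mx EFin (B *m C).
Proof.
move=> Y2 XY; apply/matrixP => k l; rewrite [LHS]mxE [RHS]mxE entryE.
rewrite covarianceDl ?Lfun2_sum ?Lfun_cst// covariance_cst_l adde0.
rewrite (@covariance_lin _ _ _ _ _ (fun j => C j l))//; last first.
  by move=> j; have /matrixP/(_ j l) := XY; rewrite !mxE.
by rewrite mxE.
Qed.

End Affine.

Lemma cov_mx_affine p q (B : 'M[R]_(q, p)) b (X : T -> 'cV[R]_p) C :
    square_integrable_vec P X -> cov_mx P X = map_mx EFin C ->
  cov_mx P (fun w => B *m X w + b) = map_mx EFin (B *m C *m B^T).
Proof.
move=> X2 XC; have Y2 := square_integrable_affine B b X2.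
have XY : cross_cov X (fun w => B *m X w + b) = map_mx EFin (C *m B^T).
  rewrite cross_covC (cross_cov_affine B b X2 X2 XC) map_trmx trmx_mul.
  congr (map_mx EFin (_ *m _)); apply/matrixP => k l.
  have /matrixP/(_ l k) := XC; have /matrixP/(_ k l) := XC.
  by rewrite !mxE covarianceC => -> [].
by rewrite -mulmxA -(cross_cov_affine B b X2 Y2 XY).
Qed.

Lemma mean_vecD p (X Y : T -> 'cV[R]_p) m m' :
    square_integrable_vec P X -> square_integrable_vec P Y ->
    mean_vec P X = map_mx EFin m -> mean_vec P Y = map_mx EFin m' ->
  mean_vec P (fun w => X w + Y w) = map_mx EFin (m + m').
Proof.
move=> X2 Y2 /matrixP Xm /matrixP Ym; apply/matrixP => k l; rewrite ord1.
have := Ym k 0; have := Xm k 0; rewrite !mxE EFinD => <- <-.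
rewrite -expectationD ?Lfun2_Lfun1//; congr expectation.
by apply/funext => w; rewrite mxE.
Qed.

Lemma cov_mxD p (X Y : T -> 'cV[R]_p) C C' :
    square_integrable_vec P X -> square_integrable_vec P Y ->
    cov_mx P X = map_mx EFin C -> cov_mx P Y = map_mx EFin C' ->
    cross_cov X Y = map_mx EFin 0 ->
  cov_mx P (fun w => X w + Y w) = map_mx EFin (C + C').
Proof.
move=> X2 Y2 /matrixP XC /matrixP YC /matrixP XY; apply/matrixP => k l.
have entryE i : (fun w => (X w + Y w) i 0) =
    (fun w => X w i 0) \+ (fun w => Y w i 0).
  by apply/funext => w; rewrite mxE.
have := YC k l; have := XC k l; have := XY k l; have := XY l k.
rewrite !mxE EFinD !entryE => lk kl <- <-.
rewrite covarianceDl ?Lfun2D// !covarianceDr// kl.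
by rewrite (covarianceC _ (fun w => Y w k 0)) lk adde0 add0e.
Qed.

End Moments.

(** * Mean and covariance of a particle *)

Section Uncorrelated.
Context {d} {T : measurableType d} {R : realType} (P : probability T R).

(** The product rule for one coordinate of [v j] and one of [eps j] is the joint
    independence on the index set made of [None] and [Some j]. *)
Lemma noise_uncorrelated J p q (v : 'I_J -> T -> 'cV[R]_p)
    (eps : 'I_J -> T -> 'cV[R]_q) j :
    mutual_indep P (noise_sigmas v eps) ->
    square_integrable_vec P (v j) -> square_integrable_vec P (eps j) ->
  cross_cov P (v j) (eps j) = map_mx EFin 0.
Proof.
move=> indep v2 e2; apply/matrixP => k l; rewrite !mxE.
have mv := Lfun2_measurable (v2 k); have me := Lfun2_measurable (e2 l).
pose X : {RV P >-> R} := HB.pack (fun w => v j w k 0)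
  (isMeasurableFun.Build _ _ _ _ _ mv).
pose Y : {RV P >-> R} := HB.pack (fun w => eps j w l 0)
  (isMeasurableFun.Build _ _ _ _ _ me).
apply: (@covariance_indep _ _ _ _ X Y (v2 k) (e2 l)) => A B mA mB.
pose K : {set option 'I_J} := [set None; Some j]%SET.
pose E (o : option 'I_J) := if o is Some _ then Y @^-1` B else X @^-1` A.
have := indep K E.
have -> : \bigcap_(i in [set` K]) E i = X @^-1` A `&` Y @^-1` B.
  apply/seteqP; split=> w /=.
    move=> KE; split; [apply: (KE None)|apply: (KE (Some j))] => /=.
      by rewrite !inE.
    by rewrite !inE eqxx orbT.
  by move=> [wA wB] i /=; rewrite !inE => /orP[] /eqP ->.
rewrite big_setU1 ?inE//= big_set1; apply=> i.
rewrite !inE => /orP[] /eqP -> F [_ FE]; apply: FE; rewrite /=.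
  by exists j, k, A.
by exists tt, l, B.
Qed.

End Uncorrelated.

Section ParticleMoments.
Context {disp} {Om : measurableType disp} {R : realType} (P : probability Om R).
Context {n d J : nat}.
Variables (H : 'M[R]_(n, d)) (Gamma : 'M[R]_n) (y : 'cV[R]_n).
Variables (mu0 : 'cV[R]_d) (C0 : 'M[R]_d).
Variables (v0 : 'I_J -> Om -> 'cV[R]_d) (eps : 'I_J -> Om -> 'cV[R]_n).
Hypothesis Gamma_pd : sym_pd Gamma.
Hypothesis v0_L2 : forall j, square_integrable_vec P (v0 j).
Hypothesis v0_mean : forall j, mean_vec P (v0 j) = map_mx EFin mu0.
Hypothesis v0_cov : forall j, cov_mx P (v0 j) = map_mx EFin C0.
Hypothesis eps_gauss : forall j, gaussian_vec P (eps j) 0 Gamma.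
Hypothesis indep : mutual_indep P (noise_sigmas v0 eps).
Variables (M : 'M[R]_d) (j : 'I_J).
Local Notation N := (1%:M - M).
Local Notation K := (Hplus H Gamma).
Local Notation mix := (fun w => M *m v0 j w + N *m (K *m (y + eps j w))).

Let Gpsd := sym_pd_psd Gamma_pd.
Let e2 := gaussian_square_integrable Gpsd (eps_gauss j).

(* The zero shift puts both summands in the form of the affine lemmas. *)
Let mixE : mix =
  (fun w => (M *m v0 j w + 0) + (N *m K *m eps j w + N *m K *m y)).
Proof.
by apply/funext => w; rewrite addr0 !mulmxDr !mulmxA [X in _ + X]addrC.
Qed.

Let L2a := square_integrable_affine M 0 (v0_L2 j).
Let L2b := square_integrable_affine (N *m K) (N *m K *m y) e2.

Lemma mean_vec_mix :
  mean_vec P mix = map_mx EFin (M *m mu0 + N *m (K *m y)).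
Proof.
rewrite mixE (mean_vecD L2a L2b (mean_vec_affine M 0 (v0_L2 j) (v0_mean j))
  (mean_vec_affine _ _ e2 (gaussian_mean Gpsd (eps_gauss j)))).
by rewrite addr0 mulmx0 add0r mulmxA.
Qed.

Lemma cov_mx_mix :
  cov_mx P mix =
    map_mx EFin (M *m C0 *m M^T + N *m mp_pinv (hess H Gamma) *m N^T).
Proof.
have cross : cross_cov P (fun w => M *m v0 j w + 0)
    (fun w => (N *m K) *m eps j w + N *m K *m y) = map_mx EFin 0.
  have e0 : cross_cov P (eps j) (v0 j) = map_mx EFin 0.
    by rewrite cross_covC (noise_uncorrelated indep (v0_L2 j) e2) map_trmx trmx0.
  rewrite (cross_cov_affine M 0 (v0_L2 j) L2b (C := 0)) ?mulmx0//.
  rewrite cross_covC (cross_cov_affine _ _ e2 (v0_L2 j) e0).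
  by rewrite map_trmx mulmx0 trmx0.
rewrite mixE (cov_mxD L2a L2b (cov_mx_affine M 0 (v0_L2 j) (v0_cov j))
  (cov_mx_affine _ _ e2 (gaussian_cov Gpsd (eps_gauss j))) cross).
by rewrite -(Hplus_Gamma H Gamma_pd) trmx_mul !mulmxA.
Qed.

End ParticleMoments.

(** * Convergence of the mean-field particles *)

Theorem theorem3p6 (R : realType) (n d J : nat)
    (disp : measure_display) (Om : measurableType disp) (P : probability Om R)
    (H : 'M[R]_(n, d)) (Gamma : 'M[R]_n) (y : 'cV[R]_n)
    (mu0 : 'cV[R]_d) (C0 : 'M[R]_d)
    (v0 : 'I_J -> Om -> 'cV[R]_d) (eps : 'I_J -> Om -> 'cV[R]_n)
    (* eigenvectors (columns of W), eigenvalues lambda_{l,i}, and the number r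
       of positive ones *)
    (W : 'M[R]_d) (lambda : nat -> 'I_d -> R) (r : nat) (le_rd : (r <= d)%N)
    (Gamma_pd : sym_pd Gamma) (C0_psd : sym_psd C0)
    (v0_L2 : forall j, square_integrable_vec P (v0 j))
    (v0_mean : forall j, mean_vec P (v0 j) = map_mx EFin mu0)
    (v0_cov : forall j, cov_mx P (v0 j) = map_mx EFin C0)
    (eps_gauss : forall j, gaussian_vec P (eps j) 0 Gamma)
    (indep : mutual_indep P (noise_sigmas v0 eps))
    (W_basis : W \in unitmx)
    (W_eigen : forall i l, mf_cov H Gamma C0 i *m hess H Gamma *m col l W =
                           lambda i l *: col l W)
    (r_count : forall i, #|[set l : 'I_d | 0 < lambda i l]%SET| = r)
    (lambda_pos : forall l : 'I_d, (l < r)%N -> 0 < lambda 1%N l)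
    (lambda_sorted : forall k l : 'I_d, (k <= l < r)%N ->
                     lambda 1%N l <= lambda 1%N k) :
  let A := hess H Gamma in
  let U := colsub (widen_ord le_rd) W in
  U^T *m A *m U = 1%:M ->
  let Pr := U *m U^T *m A in
  let S := 1%:M - Pr in
  let vstar := Hplus H Gamma *m y in
  let vstarj := fun j w => Hplus H Gamma *m (y + eps j w) in
  let v := fun j i w => mf_particleS H Gamma C0 i (v0 j w) (vstarj j w) in
  let vinf := fun j w => Pr *m vstarj j w + S *m v0 j w in
  forall j : 'I_J,
  [/\ (forall w : Om, v j i w @[i --> \oo] --> vinf j w),
      mean_vec P (v j i) @[i --> \oo] --> mean_vec P (vinf j) /\
      mean_vec P (vinf j) = map_mx EFin (Pr *m vstar + S *m mu0) &
      cov_mx P (v j i) @[i --> \oo] --> cov_mx P (vinf j) /\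
      cov_mx P (vinf j) =
        map_mx EFin (Pr *m mp_pinv A *m Pr^T + S *m C0 *m S^T)].
Proof.
move=> A U U_norm Pr S vstar vstarj v vinf j.
have M_cvg : mf_prod H Gamma C0 i @[i --> \oo] --> S.
  exact: (mf_prod_cvg Gamma_pd C0_psd W_basis W_eigen (r_count 1%N)
    lambda_pos U_norm).
have PrE : Pr = 1%:M - S by rewrite /S opprB addrC subrK.
have vE i : v j i = fun w => mf_prod H Gamma C0 i *m v0 j w +
    (1%:M - mf_prod H Gamma C0 i) *m (Hplus H Gamma *m (y + eps j w)) by [].
have vinfE : vinf j = fun w => S *m v0 j w +
    (1%:M - S) *m (Hplus H Gamma *m (y + eps j w)).
  by apply/funext => w; rewrite /vinf addrC PrE.
have mean_mix := mean_vec_mix H y Gamma_pd v0_L2 v0_mean eps_gauss.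
have cov_mix := cov_mx_mix H y Gamma_pd v0_L2 v0_cov eps_gauss indep.
split.
- by move=> w; rewrite vinfE; exact: cvg_affine_mix.
- rewrite vinfE mean_mix; split; last by rewrite PrE addrC.
  under eq_fun do rewrite vE mean_mix.
  by apply: cvg_map_mx_EFin; apply: cvg_affine_mix.
- rewrite [vinf j]vinfE cov_mix; split; last by rewrite PrE addrC.
  under eq_fun do rewrite vE cov_mix.
  by apply: cvg_map_mx_EFin; apply: cvg_congr_mix.
Qed.
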